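(* Let $\mathbf{X}=(X_\lambda,p_{\lambda\lambda'},\Lambda)$ and $\mathbf{Y}=(Y_\mu,q_{\mu\mu'},M)$ be inverse systems in a category $\mathcal{C}$ and let $(f_\mu,\phi),(f'_\mu,\phi'):\mathbf{X}\rightarrow\mathbf{Y}$ be two equivalent morphisms of inverse systems, $(f_\mu,\phi)\sim(f'_\mu,\phi')$. If the morphism $(f_\mu,\phi)$ is strongly movable, then the morphism $(f'_\mu,\phi')$ is also strongly movable.
   Context: An inverse system $\mathbf{X}=(X_\lambda,p_{\lambda\lambda'},\Lambda)$ in a category $\mathcal{C}$ consists of a directed preordered set $\Lambda$, objects $X_\lambda$, and morphisms $p_{\lambda\lambda'}:X_{\lambda'}\to X_\lambda$ for $\lambda\le\lambda'$ with $p_{\lambda\lambda}=1$ and $p_{\lambda\lambda'}\circ p_{\lambda'\lambda''}=p_{\lambda\lambda''}$. All index sets are assumed to be cofinite directed sets (each element has only finitely many predecessors). A morphism of inverse systems $(f_\mu,\phi):\mathbf{X}\to\mathbf{Y}$ consists of a function $\phi:M\to\Lambda$ and morphisms $f_\mu:X_{\phi(\mu)}\to Y_\mu$ such that whenever $\mu\le\mu'$ there is $\lambda\ge\phi(\mu),\phi(\mu')$ with $f_\mu\circ p_{\phi(\mu)\lambda}=q_{\mu\mu'}\circ f_{\mu'}\circ p_{\phi(\mu')\lambda}$. For $\lambda\ge\phi(\mu)$ write $f_{\mu\lambda}:=f_\mu\circ p_{\phi(\mu)\lambda}$. Equivalence: $(f_\mu,\phi)\sim(f'_\mu,\phi')$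 if for every $\mu\in M$ there is $\lambda\ge\phi(\mu),\phi'(\mu)$ with $f_\mu\circ p_{\phi(\mu)\lambda}=f'_\mu\circ p_{\phi'(\mu)\lambda}$. Strongly movable morphism: $(f_\mu,\phi)$ is strongly movable if every $\mu\in M$ admits $\lambda\in\Lambda$, $\lambda\ge\phi(\mu)$, such that for every $\mu'\ge\mu$ in $M$ there exist $\lambda^\ast\ge\lambda,\phi(\mu')$ and a morphism $u:X_\lambda\to Y_{\mu'}$ in $\mathcal{C}$ with $q_{\mu\mu'}\circ u=f_{\mu\lambda}$ and $u\circ p_{\lambda\lambda^\ast}=f_{\mu'\lambda^\ast}$. *)

(* Defs.v *)
From Stdlib Require Import RelationClasses.
From Stdlib Require Import Ensembles Finite_sets.

Set Implicit Arguments.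
Unset Strict Implicit.
Unset Printing Implicit Defensive.

Declare Scope pro_scope.
Delimit Scope pro_scope with pro.
Local Open Scope pro_scope.

Record Category : Type := {
  obj :> Type;
  hom : obj -> obj -> Type;
  idm : forall A : obj, hom A A;
  comp : forall A B C : obj, hom B C -> hom A B -> hom A C;
  comp_id_l : forall (A B : obj) (f : hom A B), comp (idm B) f = f;
  comp_id_r : forall (A B : obj) (f : hom A B), comp f (idm A) = f;
  comp_assoc : forall (A B C D : obj) (h : hom C D) (g : hom B C) (f : hom A B),
    comp h (comp g f) = comp (comp h g) f
}.

Arguments hom {c} A B : rename.
Arguments idm {c} A : rename.
Arguments comp {c A B C} g f : rename.

Notation "g ∘ f" := (comp g f) (at level 40, left associativity) : pro_scope.

(* Antisymmetry is not required. *)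
Record CofiniteDirectedSet : Type := {
  carrier :> Type;
  le : carrier -> carrier -> Prop;
  le_preorder : PreOrder le;
  le_directed : forall x y : carrier, exists z : carrier, le x z /\ le y z;
  le_cofinite : forall x : carrier, Finite carrier (fun y => le y x)
}.

Arguments le {c} x y : rename.

Notation "x ⪯ y" := (le x y) (at level 70, no associativity) : pro_scope.

(* The bonding morphism [bond h] takes a proof [h : l ⪯ l'] as argument; since
   [bond_id] and [bond_comp] hold for arbitrary proofs, [bond h] does not
   depend on the choice of [h]. *)
Record InverseSystem (C : Category) : Type := {
  index : CofiniteDirectedSet;
  term :> index -> C;
  bond : forall l l' : index, l ⪯ l' -> hom (term l') (term l);
  bond_id : forall (l : index) (h : l ⪯ l), bond h = idm (term l);
  bond_comp : forall (l l' l'' : index)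
    (h : l ⪯ l') (h' : l' ⪯ l'') (h'' : l ⪯ l''), bond h ∘ bond h' = bond h''
}.

Arguments index {C} X : rename.
Arguments term {C} X l : rename.
Arguments bond {C} X {l l'} h : rename.

Record SystemMorphism (C : Category) (X Y : InverseSystem C) : Type := {
  idx : index Y -> index X;
  mor : forall m : index Y, hom (X (idx m)) (Y m);
  mor_compat : forall (m m' : index Y) (h : m ⪯ m'),
    exists (l : index X) (hl : idx m ⪯ l) (hl' : idx m' ⪯ l),
      mor m ∘ bond X hl = bond Y h ∘ mor m' ∘ bond X hl'
}.

Arguments idx {C X Y} f m : rename.
Arguments mor {C X Y} f m : rename.

(* f_{m l} : X_l -> Y_m, for l ⪰ idx f m *)
Definition mor_at (C : Category) (X Y : InverseSystem C)
    (f : SystemMorphism X Y) (m : index Y) (l : index X) (h : idx f m ⪯ l) :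
    hom (X l) (Y m) :=
  mor f m ∘ bond X h.

Arguments mor_at {C X Y} f m {l} h.

Definition equivalent (C : Category) (X Y : InverseSystem C)
    (f f' : SystemMorphism X Y) : Prop :=
  forall m : index Y,
  exists (l : index X) (h : idx f m ⪯ l) (h' : idx f' m ⪯ l),
    mor f m ∘ bond X h = mor f' m ∘ bond X h'.

Definition strongly_movable (C : Category) (X Y : InverseSystem C)
    (f : SystemMorphism X Y) : Prop :=
  forall m : index Y,
  exists (l : index X) (hl : idx f m ⪯ l),
  forall (m' : index Y) (hm : m ⪯ m'),
  exists (ls : index X) (hls : l ⪯ ls) (hls' : idx f m' ⪯ ls)
         (u : hom (X l) (Y m')),
    bond Y hm ∘ u = mor_at f m hl /\ u ∘ bond X hls = mor_at f m' hls'.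

(* Main.v *)
Require Import Defs.
From Stdlib Require Import RelationClasses.

Local Open Scope pro_scope.

(** Equivalent morphisms agree at each index [m] once restricted to a
    sufficiently late term of [X], so both the stage [l] that witnesses strong
    movability at [m] and the map [u : X l -> Y m'] can be transported to [f']
    by moving further along [X]. Two kinds of stage are involved, and the order
    of choice matters. The new stage [L] for [m] must not depend on [m']: it
    lies above [l] and above a stage where [f] and [f'] agree at [m]. Given
    [m'], the new map is [u] restricted along [X L -> X l]; its first identity
    then follows from agreement at [m]. Its second identity needs agreement at
    [m'], and this may be demanded after [m'] is known, because the comparison
    stage [ls] is allowed to depend on [m']. *)

Lemma le_trans (D : CofiniteDirectedSet) (x y z : D) :
  x ⪯ y -> y ⪯ z -> x ⪯ z.
Proof. exact (PreOrder_Transitive (R := le) (PreOrder := le_preorder D) x y z). Qed.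

Lemma mor_at_bond (C : Category) (X Y : InverseSystem C)
    (f : SystemMorphism X Y) (m : index Y) (l l' : index X)
    (h : idx f m ⪯ l) (hl : l ⪯ l') (h' : idx f m ⪯ l') :
  mor_at f m h ∘ bond X hl = mor_at f m h'.
Proof.
  unfold mor_at. rewrite <- comp_assoc. now rewrite (bond_comp _ _ h').
Qed.

(** Agreement at one stage propagates to every later stage by restricting both
    sides; this lets stages be enlarged freely. *)
Lemma equivalent_eventually (C : Category) (X Y : InverseSystem C)
    (f f' : SystemMorphism X Y) (hequiv : equivalent f f') (m : index Y) :
  exists l0 : index X, idx f' m ⪯ l0 /\
    forall (l : index X) (hl : l0 ⪯ l) (h : idx f m ⪯ l) (h' : idx f' m ⪯ l),
      mor_at f m h = mor_at f' m h'.
Proof.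
  destruct (hequiv m) as (l0 & h0 & h0' & e).
  exists l0. split; [exact h0' |].
  intros l hl h h'.
  rewrite <- (mor_at_bond _ _ _ _ _ _ _ h0 hl h).
  rewrite <- (mor_at_bond _ _ _ _ _ _ _ h0' hl h').
  exact (f_equal (fun g => g ∘ bond X hl) e).
Qed.

Theorem proposition2p23 (C : Category) (X Y : InverseSystem C)
    (f f' : SystemMorphism X Y) (hequiv : equivalent f f')
    (hf : strongly_movable f) : strongly_movable f'.
Proof.
  intros m.
  destruct (hf m) as (l & hl & mov).
  destruct (equivalent_eventually _ _ _ _ _ hequiv m) as (l1 & h1 & agree).
  destruct (le_directed l l1) as (L & lL & l1L).
  exists L, (le_trans _ _ _ _ h1 l1L).
  intros m' hm.
  destruct (mov m' hm) as (ls & hls & hls' & u & lift & restr).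
  destruct (equivalent_eventually _ _ _ _ _ hequiv m') as (l2 & h2 & agree').
  destruct (le_directed ls l2) as (k & lsk & l2k).
  destruct (le_directed L k) as (K & LK & kK).
  pose proof (le_trans _ _ _ _ lsk kK) as lsK.
  pose proof (le_trans _ _ _ _ l2k kK) as l2K.
  exists K, LK, (le_trans _ _ _ _ h2 l2K), (u ∘ bond X lL).
  split.
  - rewrite comp_assoc, lift.
    rewrite (mor_at_bond _ _ _ _ _ _ _ hl lL (le_trans _ _ _ _ hl lL)).
    exact (agree L l1L _ _).
  - (* Both paths X K -> X l, through X L and through X ls, are the same bond. *)
    rewrite <- comp_assoc, (bond_comp lL LK (le_trans _ _ _ _ lL LK)).
    rewrite <- (bond_comp hls lsK (le_trans _ _ _ _ lL LK)).
    rewrite comp_assoc, restr.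
    rewrite (mor_at_bond _ _ _ _ _ _ _ hls' lsK (le_trans _ _ _ _ hls' lsK)).
    exact (agree' K l2K _ _).
Qed.
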